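(* For every sequence of positive reals $u(n)$ such that $u(n)/n^2\to\infty$, there exist $C\ge1$, $K\ge 0$ and a sequence of finite connected graphs $X_n$, each $(C,K)$-roughly transitive, such that $|X_n|\le u(\operatorname{diam}(X_n))$ for all large $n$, and such that no subsequence of $(X_n)$ has a scaling limit.
   Context: A $(C,K)$-quasi-isometry $f:X\to Y$ satisfies $C^{-1}d(x,y)-K\le d(f(x),f(y))\le Cd(x,y)+K$ and has $K$-dense image. A metric space $X$ is $(C,K)$-roughly transitive if for all $x,y\in X$ some $(C,K)$-quasi-isometry $X\to X$ sends $x$ to $y$. Graphs carry the graph metric. A sequence (or subsequence) of finite connected graphs has a scaling limit $\mathcal M$ if the graphs with metric rescaled by $1/\operatorname{diam}$ converge to the compact metric space $\mathcal M$ in the Gromov–Hausdorff distance. *)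

(* Defs.v *)
From mathcomp Require Import all_boot.
From Stdlib Require Import Reals.

Set Implicit Arguments.
Unset Strict Implicit.
Unset Printing Implicit Defensive.

Record FinGraph := {
  gV :> finType;
  gadj : rel gV;
  gadj_sym : symmetric gadj;
  gadj_irr : irreflexive gadj }.

Fixpoint gball (G : FinGraph) (x : G) (k : nat) : {set G} :=
  match k with
  | 0 => [set x]
  | k'.+1 => let B := gball x k' in
             B :|: [set y | [exists z in B, gadj z y]]
  end.

(* graph distance: least k with y in the k-ball around x
   (for connected graphs this is < #|G|, hence found by the search) *)
Definition gdist (G : FinGraph) (x y : G) : nat :=
  find (fun k => y \in gball x k) (iota 0 #|G|).

Definition gconnected (G : FinGraph) : Prop :=
  (0 < #|G|)%N /\ forall x y : G, connect (@gadj G) x y.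

Definition gdiam (G : FinGraph) : nat :=
  \max_(p : G * G) gdist p.1 p.2.

Definition quasi_iso (G : FinGraph) (C K : R) (f : G -> G) : Prop :=
  (forall a b : G,
     (INR (gdist a b) / C - K <= INR (gdist (f a) (f b)))%R /\
     (INR (gdist (f a) (f b)) <= C * INR (gdist a b) + K)%R) /\
  (forall z : G, exists a : G, (INR (gdist (f a) z) <= K)%R).

Definition roughly_transitive (G : FinGraph) (C K : R) : Prop :=
  forall x y : G, exists f : G -> G, quasi_iso C K f /\ f x = y.

Definition scaled_dist (G : FinGraph) (a b : G) : R :=
  (INR (gdist a b) / INR (gdiam G))%R.

Record MetricSpace := {
  mcarrier :> Type;
  mdist : mcarrier -> mcarrier -> R;
  mdist_ge0 : forall x y, (0 <= mdist x y)%R;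
  mdist_eq0 : forall x y, mdist x y = 0%R <-> x = y;
  mdist_sym : forall x y, mdist x y = mdist y x;
  mdist_tri : forall x y z, (mdist x z <= mdist x y + mdist y z)%R }.

Definition mopen (M : MetricSpace) (U : M -> Prop) : Prop :=
  forall x, U x -> exists r, (0 < r)%R /\ forall y, (mdist x y < r)%R -> U y.

Definition mcompact (M : MetricSpace) : Prop :=
  forall (I : Type) (U : I -> M -> Prop),
    (forall i, mopen (U i)) -> (forall x, exists i, U i x) ->
    exists s : list I, forall x, exists i, List.In i s /\ U i x.

Record CompactMetricSpace := {
  cms :> MetricSpace;
  cms_compact : mcompact cms }.

Definition GH_lt (X : Type) (dX : X -> X -> R) (Y : Type) (dY : Y -> Y -> R)
    (eps : R) : Prop :=
  exists (Z : MetricSpace) (f : X -> Z) (g : Y -> Z),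
    (forall a b, mdist (f a) (f b) = dX a b) /\
    (forall a b, mdist (g a) (g b) = dY a b) /\
    exists r, (r < eps)%R /\
      (forall a, exists b, (mdist (f a) (g b) <= r)%R) /\
      (forall b, exists a, (mdist (f a) (g b) <= r)%R).

Definition has_scaling_limit (X : nat -> FinGraph) (M : CompactMetricSpace) : Prop :=
  forall eps, (0 < eps)%R ->
    exists N, forall n, (N <= n)%N ->
      GH_lt (@scaled_dist (X n)) (@mdist M) eps.

(* Main.v *)
(** A sequence of surfaces of growing genus, discretized at scale [r], has no
scaling limit if the genus grows at a rate for which the number of points at
mutual distance comparable to the diameter is unbounded; slowing the growth of
the genus down relatively to [r] makes the volume [r^2 * 2^k * k] smaller than
any superquadratic function of the diameter.  The surface used here is tiled by
squares of side [r], indexed by the elements of the lamplighter group over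
[Z/k]: the right neighbour of a square is obtained by switching the current
lamp, the upper neighbour by moving to the next lamp.  Around each corner there
are eight squares, so that all corners are cone points of angle [4 pi].

Rough transitivity: an edgewise Lipschitz map with an edgewise Lipschitz coarse
inverse is a quasi-isometry, so only local estimates are needed.  Translations
and reflections bring any point into the quadrant of one corner, and the star of
this corner is uniformly bi-Lipschitz to a planar square, in which the centre is
pushed to the given point by a piecewise linear map fixing the boundary.

Separated points: the distance between two lamp configurations is at least [r]
times their Hamming distance, and the [m] coordinate functions on the cube
[{0,1}^m] pairwise differ at half of the [2^m] lamps.  The diameter is at most
[O(k r)]. *)

Require Import Defs.
From mathcomp Require Import all_boot all_algebra zify.
From Stdlib Require Import Reals ZArith Lra IndefiniteDescription.

Set Implicit Arguments.
Unset Strict Implicit.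
Unset Printing Implicit Defensive.
Import GRing.Theory.
Delimit Scope ring_scope with ring.
Delimit Scope nat_scope with N.

(** * Coarse equivalences of graphs *)

Definition near (G : FinGraph) (n : nat) (x y : G) : Prop := y \in gball x n.

Lemma near0 (G : FinGraph) (x : G) : near 0 x x.
Proof. by rewrite /near inE. Qed.

Lemma near_adj (G : FinGraph) n (x y z : G) : near n x y -> gadj y z -> near n.+1 x z.
Proof.
move=> xy yz; rewrite /near /= !inE; apply/orP; right; apply/existsP; exists y.
by rewrite yz andbT.
Qed.

Lemma nearS (G : FinGraph) n (x y : G) :
  near n.+1 x y -> near n x y \/ exists2 z, near n x z & gadj z y.
Proof.
rewrite /near /= !inE => /orP[|/existsP[z /andP[xz zy]]]; first by left.
by right; exists z.
Qed.

Lemma near_mono (G : FinGraph) m n (x y : G) : m <= n -> near m x y -> near n x y.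
Proof.
move=> /subnK <-; elim: (n - m) => [|k IH] // xy.
by rewrite addSn /near /= inE IH.
Qed.

Lemma near_edge (G : FinGraph) (x y : G) : gadj x y -> near 1 x y.
Proof. exact: near_adj (near0 x). Qed.

Lemma near_trans (G : FinGraph) m n (y x z : G) :
  near m x y -> near n y z -> near (m + n) x z.
Proof.
move=> xy; elim: n z => [|n IH] z.
  by rewrite addn0 {1}/near inE => /eqP ->.
case/nearS => [/IH|[w /IH xw wz]]; rewrite addnS; first exact: near_mono.
exact: near_adj xw wz.
Qed.

Lemma near_sym (G : FinGraph) n (x y : G) : near n x y -> near n y x.
Proof.
elim: n y => [|n IH] y; first by rewrite /near !inE eq_sym.
case/nearS => [/IH|[z /IH zx zy]]; first exact: near_mono.
rewrite -add1n; apply: near_trans zx; apply: near_edge.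
by rewrite gadj_sym.
Qed.

Lemma near_connect (G : FinGraph) n (x y : G) : near n x y -> connect (@gadj G) x y.
Proof.
elim: n y => [|n IH] y; first by rewrite /near inE => /eqP ->.
case/nearS => [/IH|[z /IH xz zy]] //.
exact: connect_trans xz (connect1 zy).
Qed.

Lemma gdist_le (G : FinGraph) n (x y : G) : near n x y -> gdist x y <= n.
Proof.
move=> xy; rewrite /gdist; case: (ltnP n #|G|) => nG; last first.
  by apply: leq_trans nG; rewrite -{2}(size_iota 0 #|G|) find_size.
rewrite leqNgt; apply/negP => /(before_find 0).
by rewrite nth_iota // add0n xy.
Qed.

(** The search in [gdist] stops below [#|G|]; a connecting path can be shortened to one without
    repetition, whose length is below that bound. *)
Lemma near_gdist (G : FinGraph) (x y : G) : gconnected G -> near (gdist x y) x y.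
Proof.
case=> _ /(_ x y) /connectP[p0 p0P ->{y}].
case/shortenP: p0P => p pP pU _.
have near_last: near (size p) x (last x p).
  elim/last_ind: p pP {pU} => [|p z IH] /=; first by rewrite /near inE.
  rewrite rcons_path last_rcons size_rcons => /andP[/IH xp zp].
  exact: near_adj xp zp.
have lt_p : size p < #|G|.
  by rewrite -[(size p).+1]/(size (x :: p)) -(card_uniqP pU) max_card.
have : has (fun k => last x p \in gball x k) (iota 0 #|G|).
  by apply/hasP; exists (size p); rewrite // mem_iota.
move=> H; move: (nth_find 0 H); rewrite nth_iota; first by rewrite add0n.
by rewrite -{2}(size_iota 0 #|G|) -has_find.
Qed.

Definition coarse_equiv (G : FinGraph) (C : nat) (f g : G -> G) : Prop :=
  [/\ forall a b, gadj a b -> near C (f a) (f b),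
      forall a b, gadj a b -> near C (g a) (g b),
      forall a, near C (g (f a)) a & forall a, near C (f (g a)) a].

Lemma near_lipschitz (G : FinGraph) C (f : G -> G) n a b :
  (forall a b, gadj a b -> near C (f a) (f b)) -> near n a b -> near (C * n) (f a) (f b).
Proof.
move=> fC; elim: n b => [|n IH] b.
  by rewrite {1}/near inE => /eqP ->; rewrite muln0; apply: near0.
case/nearS => [/IH|[z /IH az /fC zb]]; first by apply: near_mono; rewrite leq_mul.
by rewrite mulnS addnC; apply: near_trans az zb.
Qed.

(** The lower bound comes from the route [a], [g (f a)], [g (f b)], [b], whose two end pieces cost
    [C] each. *)
Lemma coarse_equiv_quasi_iso (G : FinGraph) (C : nat) (f g : G -> G) :
  gconnected G -> 0 < C -> coarse_equiv C f g ->
  quasi_iso (INR C) (INR (2 * C)) f.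
Proof.
move=> cG C0 [fC gC gf fg].
have C0R : (0 < INR C)%R by apply: lt_0_INR; lia.
have C1R : (1 <= INR C)%R by rewrite -[1%R]/(INR 1); apply: le_INR; lia.
split=> [a b|z]; last first.
  exists (g z); apply: le_INR; apply/leP/gdist_le.
  by apply: near_mono (fg z); lia.
have upper : gdist (f a) (f b) <= C * gdist a b.
  by apply/gdist_le/near_lipschitz => //; apply: near_gdist.
have lower : gdist a b <= 2 * C + C * gdist (f a) (f b).
  apply: gdist_le.
  have h := near_lipschitz gC (near_gdist (f a) (f b) cG).
  have := near_trans (near_trans (near_sym (gf a)) h) (gf b).
  by apply: near_mono; lia.
have/le_INR := elimT leP upper; have/le_INR := elimT leP lower.
rewrite plus_INR !mult_INR -[INR 2]/2%R => lo up.
have := pos_INR (gdist a b); have := pos_INR (gdist (f a) (f b)).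
move: (INR (gdist a b)) (INR (gdist (f a) (f b))) lo up => d d' lo up d0 d'0.
split; last by nra.
apply: (Rmult_le_reg_l (INR C)) => //.
have -> : (INR C * (d / INR C - 2 * INR C) = d - 2 * INR C * INR C)%R by field; lra.
nra.
Qed.

Definition moves (G : FinGraph) (C : nat) (a b : G) : Prop :=
  exists f g : G -> G, coarse_equiv C f g /\ f a = b.

Lemma coarse_equiv_sym (G : FinGraph) C (f g : G -> G) :
  coarse_equiv C f g -> coarse_equiv C g f.
Proof. by case. Qed.

(** Redefining [f] at the single point [a] displaces values by at most [C]; the estimates become at
    most [3 * C] on edges and [C * C + C] for the composites. *)
Lemma moves_near (G : FinGraph) C (f g : G -> G) (a b : G) :
  coarse_equiv C f g -> near C (f a) b -> moves (C * C + 3 * C) a b.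
Proof.
move=> [fC gC gf fg] fab.
pose f' x := if x == a then b else f x.
have ff' x : near C (f x) (f' x).
  by rewrite /f'; case: eqP => [->|_] //; apply: near_mono (near0 _).
exists f', g; split; last by rewrite /f' eqxx.
split.
- move=> x y /fC xy.
  have := near_trans (near_trans (near_sym (ff' x)) xy) (ff' y).
  by apply: near_mono; lia.
- by move=> x y /gC; apply: near_mono; lia.
- move=> x; have := near_trans (near_sym (near_lipschitz gC (ff' x))) (gf x).
  by apply: near_mono; lia.
- move=> x; have := near_trans (near_sym (ff' (g x))) (fg x).
  by apply: near_mono; lia.
Qed.

Lemma moves_trans (G : FinGraph) C D (b a c : G) :
  moves C a b -> moves D b c -> moves (C * D + C + D) a c.
Proof.
move=> [f [f' [[fC f'C ff ff'] <-]]] [g [g' [[gD g'D gg gg'] <-]]].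
exists (g \o f), (f' \o g'); split=> //; split=> /=.
- move=> x y /fC /(near_lipschitz gD); apply: near_mono; lia.
- move=> x y /g'D /(near_lipschitz f'C); apply: near_mono; lia.
- move=> x; have := near_trans (near_lipschitz f'C (gg (f x))) (ff x).
  apply: near_mono; lia.
- move=> x; have := near_trans (near_lipschitz gD (ff' (g' x))) (gg' x).
  apply: near_mono; lia.
Qed.

(** The coarse inverse brings [f a] back only near [a]; [moves_near] corrects this. *)
Lemma moves_sym (G : FinGraph) C (a b : G) : moves C a b -> moves (C * C + 3 * C) b a.
Proof.
by case=> f [g [fg <-]]; apply: (moves_near (coarse_equiv_sym fg)); case: fg.
Qed.

Lemma moves_mono (G : FinGraph) C D (a b : G) : C <= D -> moves C a b -> moves D a b.
Proof.
move=> CD [f [g [[h1 h2 h3 h4] fab]]]; exists f, g; split=> //; split.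
- by move=> x y /h1; apply: near_mono.
- by move=> x y /h2; apply: near_mono.
- by move=> x; apply: near_mono (h3 x).
- by move=> x; apply: near_mono (h4 x).
Qed.

Lemma automorphism_moves (G : FinGraph) (f : G -> G) (a : G) :
  injective f -> (forall x y, gadj (f x) (f y) = gadj x y) -> moves 1 a (f a).
Proof.
move=> fI fA; exists f, (invF fI); split=> //; split.
- by move=> x y xy; apply: near_edge; rewrite fA.
- by move=> x y xy; apply: near_edge; rewrite -fA !f_invF.
- by move=> x; rewrite invF_f; apply: near_mono (near0 _).
- by move=> x; rewrite f_invF; apply: near_mono (near0 _).
Qed.

(** * The square-tiled surface *)

(* [(s, j, (x, y))] is a unit cell, not a lattice point, of the square [(s, j)] of
   side [r.+1]; thus no identifications are needed at the corners.  The lamp [j]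
   is switched when the vertical sides of the square are crossed. *)
Notation cell n r :=
  ({ffun 'I_n.+3 -> bool} * 'I_n.+3 * ('I_r.+1 * 'I_r.+1))%type.

(** [inord] sends out-of-range coordinates to 0, hence the bounds on [x] and [y] in [mk_inj] and in
    the step lemmas. *)
Definition mk n r (s : {ffun 'I_n.+3 -> bool}) (j : 'I_n.+3) (x y : nat) : cell n r :=
  (s, j, (inord x, inord y)).

Definition flip n (s : {ffun 'I_n.+3 -> bool}) (j : 'I_n.+3) : {ffun 'I_n.+3 -> bool} :=
  [ffun i => s i (+) (i == j)].

Definition go_right n r (c : cell n r) : cell n r :=
  let: (s, j, (x, y)) := c in
  if x < r then mk r s j x.+1 y else mk r (flip s j) j 0 y.

Definition go_up n r (c : cell n r) : cell n r :=
  let: (s, j, (x, y)) := c in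
  if y < r then mk r s j x y.+1 else mk r s (j + 1)%ring x 0.

Definition surface_adj n r : rel (cell n r) :=
  fun c d => [|| d == go_right c, c == go_right d, d == go_up c | c == go_up d].

Lemma mk_exists n r (c : cell n r) :
  exists s j x y, [/\ x <= r, y <= r & c = mk r s j x y].
Proof.
case: c => [[s j] [x y]]; exists s, j, x, y.
by rewrite /mk !inord_val !leq_ord.
Qed.

Lemma mk_inj n r s s' j j' x x' y y' :
  x <= r -> y <= r -> x' <= r -> y' <= r ->
  @mk n r s j x y = mk r s' j' x' y' -> [/\ s = s', j = j', x = x' & y = y'].
Proof.
move=> xr yr xr' yr' [-> -> /(congr1 (@nat_of_ord _)) + /(congr1 (@nat_of_ord _))].
by rewrite !inordK ?ltnS // => -> ->.
Qed.

Lemma right_lt n r s j x y : x < r -> y <= r -> go_right (@mk n r s j x y) = mk r s j x.+1 y.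
Proof. by move=> xr yr; rewrite /go_right /mk !inordK ?xr //; lia. Qed.

Lemma right_wrap n r s j y : y <= r -> go_right (@mk n r s j r y) = mk r (flip s j) j 0 y.
Proof. by move=> yr; rewrite /go_right /mk !inordK ?ltnn. Qed.

Lemma up_lt n r s j x y : x <= r -> y < r -> go_up (@mk n r s j x y) = mk r s j x y.+1.
Proof. by move=> xr yr; rewrite /go_up /mk !inordK ?yr //; lia. Qed.

Lemma up_wrap n r s j x : x <= r -> go_up (@mk n r s j x r) = mk r s (j + 1)%ring x 0.
Proof. by move=> xr; rewrite /go_up /mk !inordK ?ltnn. Qed.

Lemma flipK n s (j : 'I_n.+3) : flip (flip s j) j = s.
Proof. by apply/ffunP => i; rewrite !ffunE addbK. Qed.

Lemma flip_neq n s (j : 'I_n.+3) : flip s j <> s.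
Proof. by move=> /ffunP /(_ j); rewrite ffunE eqxx; case: (s j). Qed.

Lemma succ_neq n (j : 'I_n.+3) : (j + 1)%ring <> j.
Proof.
move=> h; have : (j + 1 = j + 0)%ring by rewrite addr0.
by move/addrI/eqP; rewrite oner_eq0.
Qed.

(** Here it matters that there are at least three lamps: the strips above and below a given one are
    distinct. *)
Lemma succ2_neq n (j : 'I_n.+3) : (j + 1 + 1)%ring <> j.
Proof.
move=> h; have : (j + (1 + 1) = j + 0)%ring by rewrite addr0 addrA.
by move/addrI/(congr1 val).
Qed.

Lemma right_neq n r (c : cell n r) : go_right c <> c.
Proof.
have [s [j [x [y [xr yr ->]]]]] := mk_exists c.
case: (ltnP x r) => [lt_xr|le_rx]; first by rewrite right_lt // => /mk_inj []; lia.
have -> : x = r by lia.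
by rewrite right_wrap // => /mk_inj [] // /flip_neq.
Qed.

Lemma up_neq n r (c : cell n r) : go_up c <> c.
Proof.
have [s [j [x [y [xr yr ->]]]]] := mk_exists c.
case: (ltnP y r) => [lt_yr|le_ry]; first by rewrite up_lt // => /mk_inj []; lia.
have -> : y = r by lia.
by rewrite up_wrap // => /mk_inj [] // _ /succ_neq.
Qed.

Lemma surface_adj_sym n r : symmetric (@surface_adj n r).
Proof.
move=> c d; rewrite /surface_adj.
by case: (d == _); case: (c == _); case: (d == _); case: (c == _).
Qed.

Lemma surface_adj_irr n r : irreflexive (@surface_adj n r).
Proof.
move=> c; apply/negP; rewrite /surface_adj.
by case/or4P => /eqP h; [case: (@right_neq n r c)|case: (@right_neq n r c)
  |case: (@up_neq n r c)|case: (@up_neq n r c)].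
Qed.

Definition surface (n r : nat) : FinGraph :=
  Build_FinGraph (@surface_adj_sym n r) (@surface_adj_irr n r).

Lemma adj_right n r (c : surface n r) : gadj c (go_right c : surface n r).
Proof. by rewrite /= /surface_adj eqxx. Qed.

Lemma adj_up n r (c : surface n r) : gadj c (go_up c : surface n r).
Proof. by rewrite /= /surface_adj eqxx !orbT. Qed.

Lemma edge_ind n r (P : surface n r -> surface n r -> Prop) :
  (forall c d, P c d -> P d c) -> (forall c, P c (go_right c)) -> (forall c, P c (go_up c)) ->
  forall c d, gadj c d -> P c d.
Proof.
move=> symP Pr Pu c d; rewrite /= /surface_adj.
by case/or4P => /eqP ->; auto.
Qed.

Lemma right_inj n r : injective (@go_right n r).
Proof.
move=> c d.
have [s [j [x [y [xr yr ->]]]]] := mk_exists c.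
have [s' [j' [x' [y' [xr' yr' ->]]]]] := mk_exists d.
case: (ltnP x r) => h; case: (ltnP x' r) => h'.
- by rewrite !right_lt // => /mk_inj[] // -> -> [->] ->.
- have -> : x' = r by lia.
  by rewrite right_lt // right_wrap // => /mk_inj[].
- have -> : x = r by lia.
  by rewrite right_wrap // right_lt // => /mk_inj[].
- have -> : x = r by lia. have -> : x' = r by lia.
  rewrite !right_wrap // => /mk_inj[] // e ej _ ->; rewrite -ej in e *.
  by rewrite -(flipK s j) e flipK.
Qed.

Lemma up_inj n r : injective (@go_up n r).
Proof.
move=> c d.
have [s [j [x [y [xr yr ->]]]]] := mk_exists c.
have [s' [j' [x' [y' [xr' yr' ->]]]]] := mk_exists d.
case: (ltnP y r) => h; case: (ltnP y' r) => h'.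
- by rewrite !up_lt // => /mk_inj[] // -> -> -> [->].
- have -> : y' = r by lia.
  by rewrite up_lt // up_wrap // => /mk_inj[].
- have -> : y = r by lia.
  by rewrite up_wrap // up_lt // => /mk_inj[].
- have -> : y = r by lia. have -> : y' = r by lia.
  by rewrite !up_wrap // => /mk_inj[] // -> /addIr -> ->.
Qed.

(** * Symmetries of the surface *)

Definition translate n r (s0 : {ffun 'I_n.+3 -> bool}) (j0 : 'I_n.+3) (c : cell n r) :
    cell n r :=
  let: (s, j, xy) := c in ([ffun i => s (i - j0)%ring (+) s0 i], (j + j0)%ring, xy).

Definition mirror n r (c : cell n r) : cell n r :=
  let: (s, j, (x, y)) := c in mk r s j (r - x) y.

Definition upend n r (c : cell n r) : cell n r :=
  let: (s, j, (x, y)) := c in mk r [ffun i => s (- i)%ring] (- j)%ring x (r - y).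

Lemma translate_mk n r s0 j0 s j x y : translate s0 j0 (@mk n r s j x y) =
  mk r [ffun i => s (i - j0)%ring (+) s0 i] (j + j0)%ring x y.
Proof. by []. Qed.

Lemma mirror_mk n r s j x y : x <= r -> y <= r -> mirror (@mk n r s j x y) = mk r s j (r - x) y.
Proof. by move=> xr yr; rewrite /mirror {1}/mk !inordK. Qed.

Lemma upend_mk n r s j x y : x <= r -> y <= r -> upend (@mk n r s j x y) =
  mk r [ffun i => s (- i)%ring] (- j)%ring x (r - y).
Proof. by move=> xr yr; rewrite /upend {1}/mk !inordK. Qed.

(** Translation is left multiplication in the lamplighter group, while neighbouring squares differ
    by right multiplication by a generator, so the two commute. *)
Lemma translate_moves n r s0 j0 (c : surface n r) :
  moves 1 c (translate s0 j0 c : surface n r).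
Proof.
have tr (d : cell n r) : translate s0 j0 (go_right d) = go_right (translate s0 j0 d).
  have [s [j [x [y [xr yr ->]]]]] := mk_exists d.
  case: (ltnP x r) => h; first by rewrite right_lt // !translate_mk right_lt.
  have -> : x = r by lia.
  rewrite right_wrap // !translate_mk right_wrap //; congr mk.
  by apply/ffunP => i; rewrite !ffunE subr_eq addbAC.
have tu (d : cell n r) : translate s0 j0 (go_up d) = go_up (translate s0 j0 d).
  have [s [j [x [y [xr yr ->]]]]] := mk_exists d.
  case: (ltnP y r) => h; first by rewrite up_lt // !translate_mk up_lt.
  have -> : y = r by lia.
  by rewrite up_wrap // !translate_mk up_wrap // addrAC.
have ti : injective (@translate n r s0 j0).
  move=> [[s j] xy] [[s' j'] xy'] e.
  have es := congr1 (fun c : cell n r => c.1.1) e.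
  have /addIr -> := congr1 (fun c : cell n r => c.1.2) e.
  have /= -> := congr1 snd e; congr (_, _, _).
  apply/ffunP => i; move/ffunP/(_ (i + j0)%ring): es.
  by rewrite !ffunE addrK => /addIb.
apply: (@automorphism_moves (surface n r) _ c ti) => x y.
by rewrite /= /surface_adj -!tr -!tu !(eqtype.inj_eq ti).
Qed.

(** Switching a lamp is an involution, so the left and right neighbours of a square coincide; the
    reflection conjugates [go_right] to its inverse and commutes with [go_up]. *)
Lemma mirror_moves n r (c : surface n r) : moves 1 c (mirror c : surface n r).
Proof.
have mm : involutive (@mirror n r).
  move=> d; have [s [j [x [y [xr yr ->]]]]] := mk_exists d.
  by rewrite !mirror_mk ?leq_subr // subKn.
have mr (d : cell n r) : go_right (mirror (go_right d)) = mirror d.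
  have [s [j [x [y [xr yr ->]]]]] := mk_exists d.
  case: (ltnP x r) => h.
    by rewrite right_lt // !mirror_mk // right_lt //; [congr mk|]; lia.
  have -> : x = r by lia.
  by rewrite right_wrap // !mirror_mk // subn0 right_wrap // flipK subnn.
have mu (d : cell n r) : mirror (go_up d) = go_up (mirror d).
  have [s [j [x [y [xr yr ->]]]]] := mk_exists d.
  case: (ltnP y r) => h; first by rewrite up_lt // !mirror_mk // up_lt ?leq_subr.
  have -> : y = r by lia.
  by rewrite up_wrap // !mirror_mk // up_wrap // leq_subr.
have mi := inv_inj mm.
apply: (@automorphism_moves (surface n r) _ c mi) => x y.
have sw (d e : cell n r) : (mirror e == go_right (mirror d)) = (d == go_right e).
  by rewrite -(mr e) (eqtype.inj_eq (@right_inj n r)) (eqtype.inj_eq mi) eq_sym.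
rewrite /= /surface_adj -!mu !(eqtype.inj_eq mi) !sw.
by rewrite !orbA [(x == go_right y) || _]orbC.
Qed.

(** Negating positions is a group automorphism that inverts the generator moving to the next lamp;
    together with [y -> r - y] it reverses [go_up] and commutes with [go_right]. *)
Lemma upend_moves n r (c : surface n r) : moves 1 c (upend c : surface n r).
Proof.
have mm : involutive (@upend n r).
  move=> d; have [s [j [x [y [xr yr ->]]]]] := mk_exists d.
  rewrite !upend_mk ?leq_subr // subKn // opprK; congr mk.
  by apply/ffunP => i; rewrite !ffunE opprK.
have mr (d : cell n r) : go_up (upend (go_up d)) = upend d.
  have [s [j [x [y [xr yr ->]]]]] := mk_exists d.
  case: (ltnP y r) => h.
    by rewrite up_lt // !upend_mk // up_lt //; [congr mk|]; lia.
  have -> : y = r by lia.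
  by rewrite up_wrap // !upend_mk // subn0 up_wrap // opprD subrK subnn.
have mu (d : cell n r) : upend (go_right d) = go_right (upend d).
  have [s [j [x [y [xr yr ->]]]]] := mk_exists d.
  case: (ltnP x r) => h; first by rewrite right_lt // !upend_mk // right_lt ?leq_subr.
  have -> : x = r by lia.
  rewrite right_wrap // !upend_mk // right_wrap // ?leq_subr //; congr mk.
  by apply/ffunP => i; rewrite !ffunE eqr_oppLR.
have mi := inv_inj mm.
apply: (@automorphism_moves (surface n r) _ c mi) => x y.
have sw (d e : cell n r) : (upend e == go_up (upend d)) = (d == go_up e).
  by rewrite -(mr e) (eqtype.inj_eq (@up_inj n r)) (eqtype.inj_eq mi) eq_sym.
rewrite /= /surface_adj -!mu !(eqtype.inj_eq mi) !sw.
by rewrite [(x == go_up y) || _]orbC.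
Qed.

(** * The star of a corner *)

Lemma near_square n r s j x y x' y' : x <= r -> y <= r -> x' <= r -> y' <= r ->
  near (G := surface n r) ((x - x') + (x' - x) + ((y - y') + (y' - y)))
    (mk r s j x y) (mk r s j x' y').
Proof.
move=> xr yr x'r y'r.
have horizontal z d : z + d <= r -> near (G := surface n r) d (mk r s j z y) (mk r s j (z + d) y).
  elim: d => [|d IH] zd; first by rewrite addn0; apply: near0.
  apply: near_adj (IH _) _; first by lia.
  by have := adj_right (mk r s j (z + d) y : surface n r); rewrite right_lt ?addnS //; lia.
have vertical z d : z + d <= r -> near (G := surface n r) d (mk r s j x' z) (mk r s j x' (z + d)).
  elim: d => [|d IH] zd; first by rewrite addn0; apply: near0.
  apply: near_adj (IH _) _; first by lia.
  by have := adj_up (mk r s j x' (z + d) : surface n r); rewrite up_lt ?addnS //; lia.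
apply: (@near_trans _ _ _ (mk r s j x' y : surface n r)).
  case: (leqP x x') => h.
    by have := horizontal x (x' - x); rewrite subnKC // => /(_ x'r); apply: near_mono; lia.
  have := horizontal x' (x - x'); rewrite subnKC ?(ltnW h) // => /(_ xr) /near_sym.
  by apply: near_mono; lia.
case: (leqP y y') => h.
  by have := vertical y (y' - y); rewrite subnKC // => /(_ y'r); apply: near_mono; lia.
have := vertical y' (y - y'); rewrite subnKC ?(ltnW h) // => /(_ yr) /near_sym.
by apply: near_mono; lia.
Qed.

Definition corner_config n (p q : bool) : {ffun 'I_n.+3 -> bool} :=
  [ffun i => (i == 0%ring) && p || (i == (-1)%ring) && q].

(* The cell at horizontal distance [h] and vertical distance [v] from the lower left
   corner of the square of configuration 0 at position 0; the eight squares around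
   it are obtained by switching the lamps 0 ([p]) and -1 ([q]), at position 0
   ([b = true]) or -1. *)
Definition corner_cell n r (p q b : bool) (h v : nat) : cell n r :=
  mk r (corner_config n p q) (if b then 0%ring else (-1)%ring)
    (if p == q then h else r - h) (if b then v else r - v).

Definition in_star n r (c : cell n r) : bool :=
  let: (s, j, _) := c in
  ((j == 0%ring) || (j == (-1)%ring)) && (s == corner_config n (s 0%ring) (s (-1)%ring)).

(* The quadrant [{(h, v)}], in the l^oo norm, is mapped to one of the eight octants
   of the plane: the ring of radius [m] is compressed by a factor of two, with the
   horizontal axis going to a coordinate axis and the vertical one to a diagonal. *)
Definition octant (p q b : bool) (h v : nat) : Z * Z :=
  let m := Z.of_nat (maxn h v) in
  let t := Z.of_nat (v - (minn h v)./2) in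
  match p, q with
  | false, false => (m, if b then t else - t)
  | true, false => (if b then t else - t, m)
  | true, true => (- m, if b then - t else t)
  | false, true => (if b then - t else t, - m)
  end%Z.

Definition unroll n r (c : cell n r) : Z * Z :=
  let: (s, j, (x, y)) := c in
  let p := s 0%ring in let q := s (-1)%ring in let b := j == 0%ring in
  octant p q b (if p == q then x : nat else r - x) (if b then y : nat else r - y).

(** On the ring of radius [m], [h = min(m, 2 (m - t))] and [v = min(m, 2 t)] invert the compression
    by two. This is an exact right inverse of [unroll] on the square of radius [r], but a left
    inverse only up to bounded distance. *)
Definition roll n r (z : Z * Z) : cell n r :=
  let: (u, v) := z in
  if (Z.abs v <=? Z.abs u)%Z then
    corner_cell n r (u <? 0)%Z (u <? 0)%Z (if (u <? 0)%Z then (v <=? 0)%Z else (0 <=? v)%Z)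
      (Z.to_nat (Z.min (Z.abs u) (2 * (Z.abs u - Z.abs v))))
      (Z.to_nat (Z.min (Z.abs u) (2 * Z.abs v)))
  else
    corner_cell n r (0 <? v)%Z (~~ (0 <? v)%Z) (if (0 <? v)%Z then (0 <=? u)%Z else (u <=? 0)%Z)
      (Z.to_nat (Z.min (Z.abs v) (2 * (Z.abs v - Z.abs u))))
      (Z.to_nat (Z.min (Z.abs v) (2 * Z.abs u))).

Definition supdist (z w : Z * Z) : Z := Z.max (Z.abs (z.1 - w.1)) (Z.abs (z.2 - w.2)).

Lemma supdistE u v u' v' :
  supdist (u, v) (u', v') = Z.max (Z.abs (u - u')) (Z.abs (v - v')).
Proof. by []. Qed.

Lemma corner_config0 n p q : corner_config n p q 0%ring = p.
Proof. by rewrite ffunE eqxx eq_sym oppr_eq0 oner_eq0 orbF. Qed.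

Lemma corner_configN1 n p q : corner_config n p q (-1)%ring = q.
Proof. by rewrite ffunE eqxx oppr_eq0 oner_eq0. Qed.

Lemma in_starP n r (c : cell n r) :
  reflect (exists p q b h v, [/\ h <= r, v <= r & c = corner_cell n r p q b h v]) (in_star c).
Proof.
apply: (iffP idP).
  have [s [j [x [y [xr yr ->]]]]] := mk_exists c.
  rewrite /in_star /mk => /andP[jP /eqP sE].
  exists (s 0%ring), (s (-1)%ring), (j == 0%ring),
    (if s 0%ring == s (-1)%ring then x else r - x), (if j == 0%ring then y else r - y).
  split; [by case: ifP => _ //; rewrite leq_subr|by case: ifP => _ //; rewrite leq_subr|].
  rewrite /corner_cell -sE.
  have -> : (if j == 0%ring then 0%ring else (-1)%ring) = j.
    by case: eqP jP => [->|_] //= /eqP.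
  by congr mk; [case: (_ == s _)|case: (j == _)]; rewrite ?subKn.
case=> p [q [b [h [v [hr vr ->]]]]].
rewrite /in_star /corner_cell /mk corner_config0 corner_configN1 eqxx andbT.
by case: b; rewrite eqxx ?orbT.
Qed.

Lemma in_star_corner n r p q b h v : h <= r -> v <= r -> in_star (corner_cell n r p q b h v).
Proof. by move=> hr vr; apply/in_starP; exists p, q, b, h, v. Qed.

Lemma unroll_corner n r p q b h v : h <= r -> v <= r ->
  unroll (corner_cell n r p q b h v) = octant p q b h v.
Proof.
move=> hr vr; rewrite /unroll /corner_cell /mk corner_config0 corner_configN1.
have -> : ((if b then 0 else -1)%ring == 0%ring :> 'I_n.+3) = b.
  by case: b; rewrite ?eqxx // oppr_eq0 oner_eq0.
by congr octant; [case: (p == q)|case: b]; rewrite inordK ?subKn //; lia.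
Qed.

Lemma unroll_bounded n r (c : cell n r) : in_star c -> (supdist (unroll c) (0, 0) <= Z.of_nat r)%Z.
Proof.
case/in_starP => p [q [b [h [v [hr vr ->]]]]]; rewrite unroll_corner //.
rewrite /octant; case: p; case: q; case: b; cbv beta iota zeta; rewrite supdistE; lia.
Qed.

Lemma in_star_roll n r z : (supdist z (0, 0) <= Z.of_nat r)%Z -> in_star (roll n r z).
Proof.
case: z => u v; rewrite supdistE => zr.
rewrite /roll; case: Z.leb_spec => h; apply: in_star_corner; lia.
Qed.

Lemma rollK n r z : (supdist z (0, 0) <= Z.of_nat r)%Z -> unroll (roll n r z) = z.
Proof.
case: z => u v; rewrite supdistE => zr.
rewrite /roll; case: Z.leb_spec => h; rewrite unroll_corner; try lia; rewrite /octant.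
  by case: Z.ltb_spec => hu; case: Z.leb_spec => hv;
    cbv beta iota zeta delta [negb]; congr (_, _); lia.
by case: Z.ltb_spec => hu; case: Z.leb_spec => hv;
    cbv beta iota zeta delta [negb]; congr (_, _); lia.
Qed.

(** * Distances in the star *)

Lemma near_corner n r p q b h v h' v' : h <= r -> v <= r -> h' <= r -> v' <= r ->
  near (G := surface n r) ((h - h') + (h' - h) + ((v - v') + (v' - v)))
    (corner_cell n r p q b h v) (corner_cell n r p q b h' v').
Proof.
move=> hr vr h'r v'r; apply: near_mono (near_square _ _ _ _ _ _); last 4 first.
- by case: ifP; lia.
- by case: ifP; lia.
- by case: ifP; lia.
- by case: ifP; lia.
by case: ifP; case: ifP; lia.
Qed.

Lemma flip_corner0 n p q : flip (corner_config n p q) 0%ring = corner_config n (~~ p) q.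
Proof.
apply/ffunP => i; rewrite !ffunE; case: eqP => [->|_]; last by rewrite addbF.
by rewrite eq_sym oppr_eq0 oner_eq0 /= !orbF addbT.
Qed.

Lemma flip_cornerN1 n p q : flip (corner_config n p q) (-1)%ring = corner_config n p (~~ q).
Proof.
apply/ffunP => i; rewrite !ffunE; case: (i =P (-1)%ring) => [->|_]; last by rewrite addbF.
by rewrite oppr_eq0 oner_eq0 /= addbT.
Qed.

(** The corner is on the left of the squares with [p = q] and on the right of the others, so this
    edge is a wrap of [go_right] starting from whichever square has [p] different from [q]. *)
Lemma adj_vertical_axis n r p q b v : v <= r ->
  gadj (corner_cell n r p q b 0 v : surface n r)
    (corner_cell n r (if b then ~~ p else p) (if b then q else ~~ q) b 0 v : surface n r).
Proof.
move=> vr.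
pose y := if b then v else r - v.
have yr : y <= r by rewrite /y; case: (b); lia.
case: (eqVneq p q) => [->|npq].
  have qq : (if b then ~~ q else q) == (if b then q else ~~ q) = false.
    by case: (b); case: (q).
  rewrite gadj_sym /corner_cell eqxx qq subn0 -/y.
  have := adj_right (mk r (corner_config n (if b then ~~ q else q) (if b then q else ~~ q))
    (if b then 0%ring else (-1)%ring) r y : surface n r).
  by rewrite right_wrap //; case: (b); rewrite ?flip_corner0 ?flip_cornerN1 negbK.
have pq' : (if b then ~~ p else p) == (if b then q else ~~ q).
  by move: npq; case: (b); case: (p); case: (q).
rewrite /corner_cell pq' (negbTE npq) subn0 -/y.
have := adj_right (mk r (corner_config n p q)
    (if b then 0%ring else (-1)%ring) r y : surface n r).
by rewrite right_wrap //; case: (b); rewrite ?flip_corner0 ?flip_cornerN1.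
Qed.

Lemma adj_horizontal_axis n r p q b h : h <= r ->
  gadj (corner_cell n r p q b h 0 : surface n r) (corner_cell n r p q (~~ b) h 0 : surface n r).
Proof.
move=> hr; wlog: b / b = false => [H|->].
  by case: b; [rewrite gadj_sym|]; exact: H.
rewrite /corner_cell /= subn0.
have := adj_up (mk r (corner_config n p q) (-1)%ring (if p == q then h else r - h) r : surface n r).
by rewrite up_wrap ?addNr //; case: ifP; lia.
Qed.

(** Alternating the two kinds of edges runs around a cycle of length eight, so some alternating word
    of length at most four joins any two vertices. *)
Lemma near_eight_cycle (G : FinGraph) (X : bool -> bool -> bool -> G) p q b p' q' b' :
  (forall p q b, gadj (X p q b) (X (if b then ~~ p else p) (if b then q else ~~ q) b)) ->
  (forall p q b, gadj (X p q b) (X p q (~~ b))) ->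
  near 4 (X p q b) (X p' q' b').
Proof.
move=> V H.
have n1 x y : gadj x y -> near (G := G) 4 x y by move/near_edge; apply: near_mono.
have n2 x y z : gadj x y -> gadj y z -> near (G := G) 4 x z.
  by move=> /near_edge xy /(near_adj xy); apply: near_mono.
have n3 x y z w : gadj x y -> gadj y z -> gadj z w -> near (G := G) 4 x w.
  by move=> /near_edge xy /(near_adj xy) xz /(near_adj xz); apply: near_mono.
have n4 x y z w t : gadj x y -> gadj y z -> gadj z w -> gadj w t -> near (G := G) 4 x t.
  by move=> /near_edge xy /(near_adj xy) xz /(near_adj xz) xw /(near_adj xw).
have VH p1 q1 b1 := n2 _ _ _ (V p1 q1 b1) (H _ _ _).
have HV p1 q1 b1 := n2 _ _ _ (H p1 q1 b1) (V _ _ _).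
have VHV p1 q1 b1 := n3 _ _ _ _ (V p1 q1 b1) (H _ _ _) (V _ _ _).
have HVH p1 q1 b1 := n3 _ _ _ _ (H p1 q1 b1) (V _ _ _) (H _ _ _).
have VHVH p1 q1 b1 := n4 _ _ _ _ _ (V p1 q1 b1) (H _ _ _) (V _ _ _) (H _ _ _).
have V1 p1 q1 b1 := n1 _ _ (V p1 q1 b1).
have H1 p1 q1 b1 := n1 _ _ (H p1 q1 b1).
case: p q b p' q' b' => [] [] [] [] [] [];
  first [exact: near_mono (near0 _) | exact: V1 | exact: H1 | exact: VH | exact: HV
        | exact: VHV | exact: HVH | exact: VHVH].
Qed.

Lemma near_cone n r p q b h v p' q' b' h' v' : h <= r -> v <= r -> h' <= r -> v' <= r ->
  near (G := surface n r) (h + v + (h' + v') + 4)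
    (corner_cell n r p q b h v) (corner_cell n r p' q' b' h' v').
Proof.
move=> hr vr h'r v'r.
have around : near (G := surface n r) 4
    (corner_cell n r p q b 0 0) (corner_cell n r p' q' b' 0 0).
  apply: (@near_eight_cycle (surface n r) (fun p q b => corner_cell n r p q b 0 0)).
    by move=> p1 q1 b1; apply: adj_vertical_axis.
  by move=> p1 q1 b1; apply: adj_horizontal_axis.
have := near_trans (near_trans (near_corner n p q b hr vr (leq0n r) (leq0n r)) around)
  (near_corner n p' q' b' (leq0n r) (leq0n r) h'r v'r).
by apply: near_mono; lia.
Qed.

Lemma near_across_vertical n r p q b h v h' v' : h <= r -> v <= r -> h' <= r -> v' <= r ->
  near (G := surface n r) (h + h' + ((v - v') + (v' - v)) + 1)
    (corner_cell n r p q b h v)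
    (corner_cell n r (if b then ~~ p else p) (if b then q else ~~ q) b h' v').
Proof.
move=> hr vr h'r v'r.
have := near_trans (near_trans (near_corner n p q b hr vr (leq0n r) vr)
   (near_edge (adj_vertical_axis n p q b vr))) (near_corner n _ _ b (leq0n r) vr h'r v'r).
by apply: near_mono; lia.
Qed.

Lemma near_across_horizontal n r p q b h v h' v' : h <= r -> v <= r -> h' <= r -> v' <= r ->
  near (G := surface n r) (v + v' + ((h - h') + (h' - h)) + 1)
    (corner_cell n r p q b h v) (corner_cell n r p q (~~ b) h' v').
Proof.
move=> hr vr h'r v'r.
have := near_trans (near_trans (near_corner n p q b hr vr hr (leq0n r))
   (near_edge (adj_horizontal_axis n p q b hr))) (near_corner n _ _ _ hr (leq0n r) h'r v'r).
by apply: near_mono; lia.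
Qed.

Lemma near_star n r p q b h v p' q' b' h' v' : h <= r -> v <= r -> h' <= r -> v' <= r ->
  near (G := surface n r)
    (if [&& p == p', q == q' & b == b'] then (h - h') + (h' - h) + ((v - v') + (v' - v))
     else if [&& p' == (if b then ~~ p else p), q' == (if b then q else ~~ q) & b == b']
       then h + h' + ((v - v') + (v' - v)) + 1
     else if [&& p == p', q == q' & b' == ~~ b]
       then v + v' + ((h - h') + (h' - h)) + 1
     else h + v + (h' + v') + 4)
    (corner_cell n r p q b h v) (corner_cell n r p' q' b' h' v').
Proof.
move=> hr vr h'r v'r.
case: ifP => [/and3P[/eqP <- /eqP <- /eqP <-]|_]; first exact: near_corner.
case: ifP => [/and3P[/eqP -> /eqP -> /eqP <-]|_]; first exact: near_across_vertical.
case: ifP => [/and3P[/eqP <- /eqP <- /eqP ->]|_]; first exact: near_across_horizontal.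
exact: near_cone.
Qed.

(** A linear description of the octant coordinates, replacing maximum, minimum and half in the case
    analyses. *)
Lemma octant_bounds h v (m := maxn h v) (t := v - (minn h v)./2) :
  [/\ t <= m, h <= m /\ v <= m, h + 2 * t <= 2 * m + 1 /\ v <= 2 * t,
      (m <= h) \/ (2 * m <= h + 2 * t) & (m <= v) \/ (2 * t <= v + 1)].
Proof. by rewrite /m /t; split; lia. Qed.

(** Inside a square or across an axis the distances are compared directly; octants that are not
    adjacent come within distance 1 only near the origin, where the way through the corner is
    short. *)
Lemma near_unroll1 n r (c d : surface n r) : in_star c -> in_star d ->
  (supdist (unroll c) (unroll d) <= 1)%Z -> near 20 c d.
Proof.
move=> /in_starP [p [q [b [h [v [hr vr ->]]]]]] /in_starP [p' [q' [b' [h' [v' [hr' vr' ->]]]]]].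
rewrite !unroll_corner // => D.
apply: near_mono (near_star n p q b p' q' b' hr vr hr' vr'); move: D.
rewrite /octant; cbv zeta.
have [] := octant_bounds h v; have [] := octant_bounds h' v'.
move: (maxn h v) (v - _) (maxn h' v') (v' - _) => m t m' t'.
move=> tm' [hm' vm'] [h1' v1'] h2' v2' tm [hm vm] [h1 v1] h2 v2 {hr vr hr' vr'}.
case: p q b p' q' b' => [] [] [] [] [] [];
  cbv beta iota; rewrite supdistE /=; lia.
Qed.

Lemma octant_norm p q b h v : supdist (octant p q b h v) (0, 0)%Z = Z.of_nat (maxn h v).
Proof.
have [] := octant_bounds h v; rewrite /octant; cbv zeta.
by case: p q b => [] [] []; cbv beta iota; rewrite supdistE; lia.
Qed.

(** * Edges of the surface seen in the unrolled star *)

Lemma right_corner n r p q b h v : h <= r -> v <= r ->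
  go_right (corner_cell n r p q b h v) =
  let p' := if b then ~~ p else p in let q' := if b then q else ~~ q in
  if p == q then (if h < r then corner_cell n r p q b h.+1 v else corner_cell n r p' q' b r v)
  else (if 0 < h then corner_cell n r p q b h.-1 v else corner_cell n r p' q' b 0 v).
Proof.
move=> hr vr; cbv zeta.
have yr : (if b then v else r - v) <= r by case: (b); lia.
have pq' : ((if b then ~~ p else p) == (if b then q else ~~ q)) = (p != q).
  by case: (b); case: (p); case: (q).
have fl : flip (corner_config n p q) (if b then 0%ring else (-1)%ring) =
    corner_config n (if b then ~~ p else p) (if b then q else ~~ q).
  by case: (b); rewrite ?flip_corner0 ?flip_cornerN1.
rewrite /corner_cell pq'; case: (p == q); cbv beta iota delta [negb].
  case: ltnP => h'; first by rewrite right_lt.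
  have -> : h = r by lia.
  by rewrite right_wrap // fl subnn.
case: ltnP => h'; first by rewrite right_lt //; [congr mk|]; lia.
have -> : h = 0 by lia.
by rewrite subn0 right_wrap // fl.
Qed.

(** At the two positions of the star, a horizontal step switches only lamp 0 or lamp -1. The
    converse follows by reflection, which reverses [go_right]. *)
Lemma in_star_right n r (c : cell n r) : in_star (go_right c) = in_star c.
Proof.
have imp (d : cell n r) : in_star d -> in_star (go_right d).
  case/in_starP => p [q [b [h [v [hr vr ->]]]]]; rewrite right_corner //; cbv zeta.
  by case: ifP => _; case: ltnP => h'; apply: in_star_corner; lia.
have sm (d : cell n r) : in_star (mirror d) = in_star d.
  by move: d => [[s j] [x y]].
apply/idP/idP; last exact: imp.
rewrite -sm => /imp; rewrite (_ : go_right _ = mirror c) ?sm //.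
have [s [j [x [y [xr yr ->]]]]] := mk_exists c.
case: (ltnP x r) => h.
  by rewrite right_lt // !mirror_mk // right_lt //; [congr mk|]; lia.
have -> : x = r by lia.
by rewrite right_wrap // !mirror_mk // subn0 right_wrap // flipK subnn.
Qed.

Lemma up_corner n r p q b h v : h <= r -> v <= r -> ~~ (b && (v == r)) ->
  go_up (corner_cell n r p q b h v) =
  if b then corner_cell n r p q true h v.+1
  else if 0 < v then corner_cell n r p q false h v.-1 else corner_cell n r p q true h 0.
Proof.
move=> hr vr bv.
have xr : (if p == q then h else r - h) <= r by case: (p == q); lia.
case: b bv => bv; rewrite /corner_cell; first by rewrite up_lt //; lia.
case: ltnP => v0; first by rewrite up_lt //; [congr mk|]; lia.
have -> : v = 0 by lia.
by rewrite subn0 up_wrap // addNr.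
Qed.

Lemma up_corner_out n r p q h : h <= r -> in_star (go_up (corner_cell n r p q true h r)) = false.
Proof.
move=> hr; rewrite /corner_cell up_wrap; last by case: (p == q); lia.
apply/negP; rewrite add0r /in_star /mk => /andP[/orP[/eqP|/eqP]] h1.
  by have := @succ_neq n 0%ring; rewrite add0r.
by have := @succ2_neq n (-1)%ring; rewrite addNr add0r.
Qed.

(** The outer vertical sides of the star are glued to each other, so an edge between two cells of
    the star may join distant boundary points of the planar square. The second alternative covers
    such edges, as well as those leaving or avoiding the star. *)
Lemma star_edge n r (c d : surface n r) : gadj c d ->
  [/\ in_star c, in_star d & (supdist (unroll c) (unroll d) <= 1)%Z] \/
  ((in_star c -> supdist (unroll c) (0, 0) = Z.of_nat r) /\
   (in_star d -> supdist (unroll d) (0, 0) = Z.of_nat r))%Z.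
Proof.
move: c d; apply: edge_ind.
- move=> c d [[cS dS cd]|[cS dS]]; [left|right]; split=> //.
  by move: cd; rewrite /supdist; lia.
- move=> c; case cS: (in_star c); last by right; rewrite in_star_right cS.
  move/in_starP: cS => [p [q [b [h [v [hr vr ->]]]]]].
  rewrite right_corner //; cbv zeta; case: (eqVneq p q) => [->|pq]; case: ltnP => h'.
  + left; rewrite !in_star_corner //; split=> //; rewrite !unroll_corner // /octant.
    by case: q; case: b; cbv beta iota zeta; rewrite supdistE; lia.
  + by right; rewrite !unroll_corner // !octant_norm; split=> _; lia.
  + left; rewrite !in_star_corner //; last lia.
    split=> //; rewrite !unroll_corner //; last lia.
    by move: pq; rewrite /octant; case: p; case: q; case: b => // _;
      cbv beta iota zeta; rewrite supdistE; lia.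
  + left; rewrite !in_star_corner //.
    split=> //; rewrite !unroll_corner //.
    by move: pq; rewrite /octant; case: p; case: q; case: b => // _;
      cbv beta iota zeta; rewrite supdistE; lia.
move=> c; case cS: (in_star c).
  move/in_starP: (cS) => [p [q [b [h [v [hr vr cE]]]]]] {cS}; rewrite cE {c cE}.
  case: (boolP (b && (v == r))) => [/andP[-> /eqP ->]|bv].
    right; rewrite up_corner_out // unroll_corner // octant_norm; split=> // _; lia.
  left; rewrite up_corner //; case: b bv => bv.
    rewrite !in_star_corner //; last lia.
    split=> //; rewrite !unroll_corner // /octant; last lia.
    by case: p; case: q; cbv beta iota zeta; rewrite supdistE; lia.
  case: ltnP => v0.
    rewrite !in_star_corner //; last lia.
    split=> //; rewrite !unroll_corner // /octant; last lia.
    by case: p; case: q; cbv beta iota zeta; rewrite supdistE; lia.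
  rewrite !in_star_corner //.
  split=> //; rewrite !unroll_corner // /octant.
  by case: p; case: q; cbv beta iota zeta; rewrite supdistE; lia.
right; split=> // uS.
have [s [j [x [y [xr yr cE]]]]] := mk_exists c.
case: (ltnP y r) => yr'.
  by move: uS cS; rewrite cE up_lt // /in_star /mk => ->.
move: uS cS; rewrite cE; have -> : y = r by lia.
rewrite up_wrap // => uS; case/in_starP: (uS) => p [q [b [h [v [hr vr E]]]]].
rewrite E unroll_corner // octant_norm.
(* If [b] holds, [c] lies in strip -1 and hence in the star, a contradiction; otherwise the step
   enters the bottom row of strip -1, where [v = r]. *)
case: b E => /mk_inj [] //.
- by case: (p == q); lia.
- move=> sE jE _ _; rewrite sE /in_star /mk corner_config0 corner_configN1 eqxx andbT.
  have -> : j = (-1)%ring by apply/eqP; rewrite -addr_eq0 jE.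
  by rewrite eqxx orbT.
- by case: (p == q); lia.
- by lia.
by move=> *; lia.
Qed.

(** * Pushing the corner *)

(* [slide a] is supported in [[-a, 2a]]: it stretches [[-a, 0]] onto [[-a, a]] and
   compresses [[0, 2a]] onto [[a, 2a]]. *)
Definition slide (a x : Z) : Z :=
  (if (x <=? - a) || (2 * a <=? x) then x
   else if x <=? 0 then 2 * x + a else x / 2 + a)%Z.

Definition unslide (a x : Z) : Z :=
  (if (x <=? - a) || (2 * a <=? x) then x
   else if x <=? a then (x - a) / 2 else 2 * (x - a))%Z.

Ltac slide_lia :=
  rewrite /slide /unslide;
  repeat match goal with
  | |- context [(?x <=? ?y)%Z] =>
      lazymatch x with context [Z.leb] => fail | _ => idtac end;
      case: (Z.leb_spec x y) => ?; cbv beta iota delta [orb]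
  end; Z.to_euclidean_division_equations; lia.

(** A joint estimate in the amount and the point, since in [push] the amount depends on the other
    coordinate. *)
Lemma slide_lipschitz a a' x x' : (0 <= a)%Z -> (0 <= a')%Z ->
  (Z.abs (slide a x - slide a' x') <= 2 * Z.abs (x - x') + 2 * Z.abs (a - a') + 1)%Z.
Proof. move=> a0 a'0; slide_lia. Qed.

Lemma unslide_lipschitz a a' x x' : (0 <= a)%Z -> (0 <= a')%Z ->
  (Z.abs (unslide a x - unslide a' x') <= 2 * Z.abs (x - x') + 2 * Z.abs (a - a') + 1)%Z.
Proof. move=> a0 a'0; slide_lia. Qed.

Lemma slideK a x : (0 <= a)%Z -> (Z.abs (unslide a (slide a x) - x) <= 1)%Z.
Proof. move=> a0; slide_lia. Qed.

Lemma unslideK a x : (0 <= a)%Z -> (Z.abs (slide a (unslide a x) - x) <= 1)%Z.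
Proof. move=> a0; slide_lia. Qed.

Lemma slide_id a x : (x <= - a \/ 2 * a <= x)%Z -> slide a x = x.
Proof. move=> xa; slide_lia. Qed.

Lemma unslide_id a x : (x <= - a \/ 2 * a <= x)%Z -> unslide a x = x.
Proof. move=> xa; slide_lia. Qed.

Lemma slide0 a : (0 <= a)%Z -> slide a 0 = a.
Proof. move=> a0; slide_lia. Qed.

Lemma slide_bounded a x r : (0 <= a)%Z -> (2 * a <= r)%Z -> (Z.abs x <= r)%Z ->
  (Z.abs (slide a x) <= r)%Z.
Proof. move=> a0 ar xr; slide_lia. Qed.

Lemma unslide_bounded a x r : (0 <= a)%Z -> (2 * a <= r)%Z -> (Z.abs x <= r)%Z ->
  (Z.abs (unslide a x) <= r)%Z.
Proof. move=> a0 ar xr; slide_lia. Qed.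

Definition tent (c a x : Z) : Z := Z.max 0 (a - Z.abs (x - c)).

Lemma tent_ge0 c a x : (0 <= tent c a x)%Z.
Proof. exact: Z.le_max_l. Qed.

Lemma tent_le c a x : (0 <= a)%Z -> (tent c a x <= a)%Z.
Proof. by rewrite /tent; lia. Qed.

Lemma tent_lipschitz c a x y : (Z.abs (tent c a x - tent c a y) <= Z.abs (x - y))%Z.
Proof. by rewrite /tent; lia. Qed.

(** A horizontal slide takes the origin to [(s, 0)], then a vertical one takes [(s, 0)] to [(s, t)];
    the tents make each slide fade out away from its line. *)
Definition push (s t : Z) (z : Z * Z) : Z * Z :=
  let u := slide (tent 0 s z.2) z.1 in (u, slide (tent s t u) z.2).

Definition pull (s t : Z) (z : Z * Z) : Z * Z :=
  let v := unslide (tent s t z.1) z.2 in (unslide (tent 0 s v) z.1, v).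

Definition square_map (r : Z) (F : Z * Z -> Z * Z) : Prop :=
  [/\ forall z w, (supdist z w <= 1)%Z -> (supdist (F z) (F w) <= 13)%Z,
      forall z, (supdist z (0, 0) <= r)%Z -> (supdist (F z) (0, 0) <= r)%Z &
      forall z, (supdist z (0, 0) = r)%Z -> F z = z].

Lemma supdist_le u v u' v' k :
  (supdist (u, v) (u', v') <= k <-> Z.abs (u - u') <= k /\ Z.abs (v - v') <= k)%Z.
Proof. by rewrite supdistE; lia. Qed.

(** A unit step becomes at most [2 + 2 + 1 = 5] after the first slide and [2 + 2 * 5 + 1 = 13] after
    the second. The room [2 * s <= r] makes both slides trivial on the boundary. *)
Lemma push_square_map r s t : (0 <= t <= s)%Z -> (2 * s <= r)%Z -> square_map r (push s t).
Proof.
move=> [t0 ts] sr; have s0 := Z.le_trans _ _ _ t0 ts.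
split=> [[u v] [u' v']|[u v]|[u v]]; rewrite /push /fst /snd; cbv zeta.
- rewrite !supdist_le => -[uu vv].
  have h := slide_lipschitz (x := u) (x' := u') (@tent_ge0 0 s v) (@tent_ge0 0 s v').
  have th := @tent_lipschitz 0 s v v'.
  move: (slide (tent 0 s v) u) (slide (tent 0 s v') u') h => x x' h.
  have h' := slide_lipschitz (x := v) (x' := v') (@tent_ge0 s t x) (@tent_ge0 s t x').
  have th' := @tent_lipschitz s t x x'.
  by clear -uu vv h th h' th'; split; lia.
- rewrite !supdist_le !Z.sub_0_r => -[ur vr].
  have sl := @tent_le 0 _ v s0.
  split; first by apply: slide_bounded ur; [exact: tent_ge0|lia].
  by apply: slide_bounded vr; [exact: tent_ge0|];
    have := @tent_le s _ (slide (tent 0 s v) u) t0; lia.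
rewrite supdistE => uv.
have ur : slide (tent 0 s v) u = u by apply: slide_id; rewrite /tent; lia.
by rewrite ur slide_id //; rewrite /tent; lia.
Qed.

Lemma pull_square_map r s t : (0 <= t <= s)%Z -> (2 * s <= r)%Z -> square_map r (pull s t).
Proof.
move=> [t0 ts] sr; have s0 := Z.le_trans _ _ _ t0 ts.
split=> [[u v] [u' v']|[u v]|[u v]]; rewrite /pull /fst /snd; cbv zeta.
- rewrite !supdist_le => -[uu vv].
  have h := unslide_lipschitz (x := v) (x' := v') (@tent_ge0 s t u) (@tent_ge0 s t u').
  have th := @tent_lipschitz s t u u'.
  move: (unslide (tent s t u) v) (unslide (tent s t u') v') h => y y' h.
  have h' := unslide_lipschitz (x := u) (x' := u') (@tent_ge0 0 s y) (@tent_ge0 0 s y').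
  have th' := @tent_lipschitz 0 s y y'.
  by clear -uu vv h th h' th'; split; lia.
- rewrite !supdist_le !Z.sub_0_r => -[ur vr].
  have tl := @tent_le s _ u t0.
  split; last by apply: unslide_bounded vr; [exact: tent_ge0|lia].
  by apply: unslide_bounded ur; [exact: tent_ge0|];
    have := @tent_le 0 _ (unslide (tent s t u) v) s0; lia.
rewrite supdistE => uv.
have vr : unslide (tent s t u) v = v by apply: unslide_id; rewrite /tent; lia.
by rewrite vr unslide_id //; rewrite /tent; lia.
Qed.

(** Undoing the vertical slide errs by at most 1; this perturbs the horizontal amount, at cost
    [2 * 1 + 1], and undoing the horizontal slide adds 1. *)
Lemma pushK s t z : (supdist (pull s t (push s t z)) z <= 4)%Z.
Proof.
case: z => u v; rewrite /pull /push /fst /snd; cbv zeta; rewrite supdist_le.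
have h := slideK (x := u) (@tent_ge0 0 s v).
move: (slide _ u) h => x h.
have h' := slideK (x := v) (@tent_ge0 s t x).
move: (unslide _ (slide _ v)) h' => y h'.
have th := @tent_lipschitz 0 s y v.
have := unslide_lipschitz (x := x) (x' := x) (@tent_ge0 0 s y) (@tent_ge0 0 s v).
by move: th h h'; lia.
Qed.

Lemma pullK s t z : (supdist (push s t (pull s t z)) z <= 4)%Z.
Proof.
case: z => u v; rewrite /pull /push /fst /snd; cbv zeta; rewrite supdist_le.
have h := unslideK (x := v) (@tent_ge0 s t u).
move: (unslide _ v) h => y h.
have h' := unslideK (x := u) (@tent_ge0 0 s y).
move: (slide _ (unslide _ u)) h' => x h'.
have th := @tent_lipschitz s t x u.
have := slide_lipschitz (x := y) (x' := y) (@tent_ge0 s t x) (@tent_ge0 s t u).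
by move: th h h'; lia.
Qed.

Lemma push0 s t : (0 <= t <= s)%Z -> push s t (0, 0)%Z = (s, t).
Proof.
move=> ts; rewrite /push /fst /snd; cbv zeta.
have -> : tent 0 s 0 = s by rewrite /tent; lia.
rewrite slide0; last lia.
have -> : tent s t s = t by rewrite /tent; lia.
by rewrite slide0; [|lia].
Qed.

(** * Transport of planar maps to the star *)

Lemma near_roll n r k z w :
  (supdist z (0, 0) <= Z.of_nat r)%Z -> (supdist w (0, 0) <= Z.of_nat r)%Z ->
  (supdist z w <= Z.of_nat k)%Z ->
  near (G := surface n r) (20 * k) (roll n r z) (roll n r w).
Proof.
case: w => u' v'; elim: k z => [|k IH] [u v] zr wr zw.
  have -> : u = u' by move: zw; rewrite supdistE; lia.
  have -> : v = v' by move: zw; rewrite supdistE; lia.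
  exact: near0.
(* Each coordinate moves by at most one towards its target, so the walk stays in the square and each
   step costs 20. *)
pose step x y := Z.max (x - 1) (Z.min (x + 1) y).
have xr : (supdist (step u u', step v v') (0, 0) <= Z.of_nat r)%Z.
  by move: zr wr; rewrite !supdist_le /step; lia.
rewrite mulnS; apply: (@near_trans (surface n r) _ _ (roll n r (step u u', step v v'))).
  apply: near_unroll1; rewrite ?in_star_roll ?rollK //.
  by rewrite /step supdist_le; lia.
by apply: IH => //; move: zw; rewrite !supdist_le /step; lia.
Qed.

Lemma near_roll_unroll n r (c : surface n r) : in_star c ->
  near (G := surface n r) 20 (roll n r (unroll c)) c.
Proof.
move=> cS; have cr := unroll_bounded cS.
apply: near_unroll1; rewrite ?in_star_roll // rollK //.
by case: (unroll c) => u v; rewrite supdistE; lia.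
Qed.

Definition star_map n r (F : Z * Z -> Z * Z) (c : surface n r) : surface n r :=
  if in_star c then roll n r (F (unroll c)) else c.

(** An edge that stays short in the plane costs [20 * 13 = 260]. Otherwise its ends in the star lie
    on the boundary, which [F] fixes, and each end moves by at most 20. *)
Lemma near_star_map n r F (c d : surface n r) : square_map (Z.of_nat r) F ->
  gadj c d -> near 260 (star_map F c) (star_map F d).
Proof.
move=> [F1 Fr Fid] cd.
case: (star_edge cd) => [[cS dS cd1]|[cS dS]].
  rewrite /star_map cS dS.
  by apply: (@near_roll n r 13); [exact/Fr/unroll_bounded..|exact: F1].
have fix_near (e : surface n r) :
    (in_star e -> supdist (unroll e) (0, 0)%Z = Z.of_nat r) -> near 20 (star_map F e) e.
  rewrite /star_map; case eS: (in_star e) => h; last exact: near_mono (near0 _).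
  by rewrite Fid ?h //; apply: near_roll_unroll.
have := near_trans (near_trans (fix_near _ cS) (near_edge cd)) (near_sym (fix_near _ dS)).
exact: near_mono.
Qed.

Lemma near_star_mapK n r F F' (c : surface n r) :
  square_map (Z.of_nat r) F -> square_map (Z.of_nat r) F' ->
  (forall z, supdist (F' (F z)) z <= 4)%Z -> near 260 (star_map F' (star_map F c)) c.
Proof.
move=> [_ Fr _] [_ F'r _] FK.
rewrite {2}/star_map; case cS: (in_star c); last first.
  by rewrite /star_map cS; apply: near_mono (near0 _).
have cr := unroll_bounded cS.
rewrite /star_map in_star_roll ?rollK; try exact: Fr.
have := near_trans (@near_roll n r 4 _ _ (F'r _ (Fr _ cr)) cr (FK _)) (near_roll_unroll cS).
exact: near_mono.
Qed.

Lemma star_map_coarse_equiv n r s t : (0 <= t <= s)%Z -> (2 * s <= Z.of_nat r)%Z ->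
  coarse_equiv (G := surface n r) 260 (star_map (push s t)) (star_map (pull s t)).
Proof.
move=> ts sr; have pu := push_square_map ts sr; have pl := pull_square_map ts sr.
split=> *.
- exact: near_star_map.
- exact: near_star_map.
- exact/near_star_mapK/pushK.
- exact/near_star_mapK/pullK.
Qed.

Definition base_cell n r : surface n r := mk r [ffun => false] 0%ring 0 0.

Lemma base_cell_corner n r : base_cell n r = corner_cell n r false false true 0 0.
Proof.
rewrite /base_cell /corner_cell; congr mk.
by apply/ffunP => i; rewrite !ffunE !andbF.
Qed.

Lemma moves_in_quadrant n r x y : 2 * x <= r -> 2 * y <= r ->
  moves (G := surface n r) (260 * 260 + 3 * 260) (base_cell n r) (mk r [ffun => false] 0%ring x y).
Proof.
move=> xr yr.
have -> : mk r [ffun => false] 0%ring x y = corner_cell n r false false true x y.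
  rewrite /corner_cell; congr mk.
  by apply/ffunP => i; rewrite !ffunE !andbF.
have xr' : x <= r by lia.
have yr' : y <= r by lia.
have [tm [hm vm] _ _ _] := octant_bounds x y.
(* The push goes to the unrolled image [(s, t)] of the target; being in the quarter of the square
   near the corner gives [2 * s <= r]. *)
set s := Z.of_nat (maxn x y); set t := Z.of_nat (y - (minn x y)./2).
have e := @star_map_coarse_equiv n r s t ltac:(lia) ltac:(lia).
apply: (moves_near e); rewrite /star_map base_cell_corner in_star_corner // unroll_corner //.
rewrite [octant _ _ _ 0 0](_ : _ = (0, 0)%Z) // push0; last lia.
have <- : unroll (corner_cell n r false false true x y) = (s, t) by rewrite unroll_corner.
by apply: near_mono (near_roll_unroll _) => //; apply: in_star_corner.
Qed.

(** * Diameter and lower bounds on distances *)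

(** Pushing covers the quarter of the square next to the corner, the two reflections extend this to
    the square, and translations to all squares. *)
Lemma moves_from_base : exists C, forall n r (c : surface n r), moves C (base_cell n r) c.
Proof.
have [A quadrant] : exists A, forall n r x y, 2 * x <= r -> 2 * y <= r ->
    moves (G := surface n r) A (base_cell n r) (mk r [ffun => false] 0%ring x y).
  by eexists; exact: moves_in_quadrant.
have moves1 (n r : nat) B (c d e : surface n r) :
    moves B c d -> moves 1 d e -> moves (2 * B + 1) c e.
  by move=> cd /(moves_trans cd); apply: moves_mono; lia.
exists (2 * (2 * (2 * A + 1) + 1) + 1) => n r c.
have [s [j [x [y [xr yr ->]]]]] := mk_exists c.
have horizontal y' : 2 * y' <= r ->
    moves (G := surface n r) (2 * A + 1) (base_cell n r) (mk r [ffun => false] 0%ring x y').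
  move=> yr'; case: (leqP (2 * x) r) => xr'.
    by apply: moves_mono (quadrant _ _ _ _ xr' yr'); lia.
  apply: (@moves1 _ _ _ _ (mk r [ffun => false] 0%ring (r - x) y')).
    by apply: quadrant; lia.
  have -> : mk r [ffun => false] 0%ring x y' = mirror (@mk n r [ffun => false] 0%ring (r - x) y').
    by rewrite mirror_mk ?subKn //; lia.
  exact: mirror_moves.
have vertical : moves (G := surface n r) (2 * (2 * A + 1) + 1)
    (base_cell n r) (mk r [ffun => false] 0%ring x y).
  case: (leqP (2 * y) r) => yr'; first by apply: moves_mono (horizontal _ yr'); lia.
  apply: (@moves1 _ _ _ _ (mk r [ffun => false] 0%ring x (r - y))).
    by apply: horizontal; lia.
  have -> : mk r [ffun => false] 0%ring x y = upend (@mk n r [ffun => false] 0%ring x (r - y)).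
    rewrite upend_mk ?subKn ?leq_subr // oppr0; congr mk.
    by apply/ffunP => i; rewrite !ffunE.
  exact: upend_moves.
apply: (@moves1 _ _ _ _ (mk r [ffun => false] 0%ring x y)) => //.
have -> : mk r s j x y = translate s j (@mk n r [ffun => false] 0%ring x y).
  rewrite translate_mk add0r; congr mk.
  by apply/ffunP => i; rewrite !ffunE.
exact: translate_moves.
Qed.

Lemma near_toggle n r s j y : y <= r ->
  near (G := surface n r) r.+1 (mk r s j 0 y) (mk r (flip s j) j 0 y).
Proof.
move=> yr; rewrite -add1n; apply: (@near_trans _ _ _ (mk r (flip s j) j r y : surface n r)).
  apply/near_sym/near_edge.
  by have := adj_right (mk r (flip s j) j r y : surface n r); rewrite right_wrap // flipK.
by apply: near_mono (near_square _ _ _ _ _ _) => //; lia.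
Qed.

Lemma near_next_strip n r s j :
  near (G := surface n r) r.+1 (mk r s j 0 0) (mk r s (j + 1)%ring 0 0).
Proof.
rewrite -addn1; apply: (@near_trans _ _ _ (mk r s j 0 r : surface n r)).
  by apply: near_mono (near_square _ _ _ _ _ _) => //; lia.
apply: near_edge.
by have := adj_up (mk r s j 0 r : surface n r); rewrite up_wrap.
Qed.

Lemma near_later_strip n r s j i :
  near (G := surface n r) (i * r.+1) (mk r s j 0 0) (mk r s (j + i%:R)%ring 0 0).
Proof.
elim: i => [|i IH]; first by rewrite addr0; apply: near0.
rewrite mulSn addnC mulrSr addrA; apply: near_trans IH _; exact: near_next_strip.
Qed.

(** A walk through the strips that switches off the lit lamps: each lamp costs at most [r.+1] to
    toggle and [r.+1] to pass. *)
Lemma near_extinguish n r (s : {ffun 'I_n.+3 -> bool}) i : i <= n.+3 ->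
  near (G := surface n r) (i * (2 * r.+1)) (mk r s 0%ring 0 0)
    (mk r [ffun l : 'I_n.+3 => (i <= l) && s l] (i%:R)%ring 0 0).
Proof.
elim: i => [|i IH] ik.
  have -> : [ffun l : 'I_n.+3 => (0 <= l) && s l] = s by apply/ffunP => l; rewrite ffunE.
  exact: near0.
rewrite mulSn addnC; apply: near_trans (IH (ltnW ik)) _.
have il (l : 'I_n.+3) : (l == i%:R%ring) = (i == l :> nat).
  by rewrite -val_eqE Zp_nat /= modn_small // eq_sym.
rewrite mul2n -addnn mulrSr; set s' := [ffun l : 'I_n.+3 => (i < l) && s l].
apply: (@near_trans (surface n r) _ _ (mk r s' (i%:R)%ring 0 0)); last exact: near_next_strip.
case si: (s (i%:R)%ring).
  have -> : s' = flip [ffun l : 'I_n.+3 => (i <= l) && s l] (i%:R)%ring; last exact: near_toggle.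
  apply/ffunP => l; rewrite !ffunE il (leq_eqVlt i).
  case: eqP => [e|_] /=; last by rewrite addbF.
  have /eqP lE : l == i%:R%ring by rewrite il e.
  by rewrite {1}e ltnn lE si.
have -> : s' = [ffun l : 'I_n.+3 => (i <= l) && s l]; last exact: near_mono (near0 _).
apply/ffunP => l; rewrite !ffunE (leq_eqVlt i).
case: eqP => [e|_] //=.
have /eqP lE : l == i%:R%ring by rewrite il e.
by rewrite {1}e ltnn lE si.
Qed.

(** Go to the lower left cell of the square, then up [- j] strips to strip 0, then once around the
    circle while extinguishing all lamps. *)
Lemma near_base n r (c : surface n r) : near (4 * n.+3 * r.+1) c (base_cell n r).
Proof.
have [s [j [x [y [xr yr ->]]]]] := mk_exists c.
have h1 := near_square s j xr yr (leq0n r) (leq0n r).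
have h2 := @near_later_strip n r s j (- j)%ring.
rewrite natr_Zp addrN in h2.
have h3 := near_extinguish r s (leqnn n.+3).
have h := near_trans (near_trans h1 h2) h3.
move: h; have -> : (n.+3)%:R%ring = 0%ring :> 'I_n.+3.
  by apply: val_inj; rewrite Zp_nat /= modnn.
have -> : [ffun l : 'I_n.+3 => (n.+3 <= l) && s l] = [ffun => false].
  by apply/ffunP => l; rewrite !ffunE leqNgt ltn_ord.
apply: near_mono; have := ltn_ord (- j)%ring; nia.
Qed.

Lemma surface_connected n r : gconnected (surface n r).
Proof.
split; first by apply/card_gt0P; exists (base_cell n r).
move=> x y; apply: near_connect.
exact: near_trans (near_base x) (near_sym (near_base y)).
Qed.

Lemma gdiam_surface_le n r : gdiam (surface n r) <= 8 * n.+3 * r.+1.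
Proof.
apply/bigmax_leqP => -[x y] _; apply: gdist_le.
apply: near_mono (near_trans (near_base x) (near_sym (near_base y))); lia.
Qed.

(** * A Lipschitz function controlled by the Hamming distance *)

Definition lamp_weight n r (j i : 'I_n.+3) (y : nat) : nat :=
  if i == j then 0 else if i == (j + 1)%ring then r.+1 - y
  else if i == (j - 1)%ring then y.+1 else r.+1.

(* Lamps are weighted by the vertical distance to the strip where they can be
   switched, cut off at the height of a strip. *)
Definition potential n r (s0 : {ffun 'I_n.+3 -> bool}) (c : cell n r) : nat :=
  let: (s, j, (_, y)) := c in \sum_i (s i != s0 i) * lamp_weight r j i y.

Lemma potential_mk n r s0 s j x y : y <= r ->
  potential s0 (@mk n r s j x y) = \sum_i (s i != s0 i) * lamp_weight r j i y.
Proof. by move=> yr; rewrite /potential /mk inordK. Qed.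

Lemma potential_le n r (s s0 : {ffun 'I_n.+3 -> bool}) (j j' l : 'I_n.+3) y y' :
  (forall i, lamp_weight r j i y <= lamp_weight r j' i y' + (i == l)) ->
  \sum_i (s i != s0 i) * lamp_weight r j i y <=
  (\sum_i (s i != s0 i) * lamp_weight r j' i y').+1.
Proof.
move=> w_le.
have /leq_trans -> // : \sum_i (s i != s0 i) * lamp_weight r j i y <=
    \sum_i ((s i != s0 i) * lamp_weight r j' i y' + (i == l)).
  by apply: leq_sum => i _; have := w_le i; case: (s i != s0 i); rewrite ?mul1n.
rewrite big_split /= -[X in _ <= X]addn1 leq_add2l (bigD1 l) //= eqxx big1 // => i /negbTE -> //.
Qed.

(** Crossing a vertical side switches lamp [j], whose weight is 0; a vertical step raises the weight
    of at most one lamp and lowers that of at most one, each by 1. *)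
Lemma potential_adj n r s0 (c d : surface n r) : gadj c d ->
  potential s0 c <= (potential s0 d).+1 /\ potential s0 d <= (potential s0 c).+1.
Proof.
move: c d; apply: edge_ind => [c d []|c|c] //.
  have [s [j [x [y [xr yr ->]]]]] := mk_exists c.
  case: (ltnP x r) => h; first by rewrite right_lt // !potential_mk.
  have -> : x = r by lia.
  rewrite right_wrap // !potential_mk //.
  suff -> : \sum_i (flip s j i != s0 i) * lamp_weight r j i y =
    \sum_i (s i != s0 i) * lamp_weight r j i y by [].
  apply: eq_bigr => i _; rewrite ffunE /lamp_weight.
  by case: (i == j); rewrite ?muln0 ?addbF.
have [s [j [x [y [xr yr ->]]]]] := mk_exists c.
have n1 (i : 'I_n.+3) : i == (j + 1)%ring -> (i == j) = false.
  by move/eqP => ->; apply/eqP; exact: succ_neq.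
have n2 (i : 'I_n.+3) : i == (j + 1 + 1)%ring -> (i == j) = false.
  by move/eqP => ->; apply/eqP; exact: succ2_neq.
have n3 : ((j + 1)%ring == (j + 1 + 1)%ring) = false.
  by rewrite eq_sym; apply/eqP; exact: succ_neq.
case: (ltnP y r) => h.
  rewrite up_lt // !potential_mk //.
  split; [apply: (@potential_le _ _ _ _ _ _ (j + 1)%ring)
         |apply: (@potential_le _ _ _ _ _ _ (j - 1)%ring)] => i;
    rewrite /lamp_weight; case: (i == j) => //; case: (i == (j + 1)%ring);
    case: (i == (j - 1)%ring); lia.
have -> : y = r by lia.
rewrite up_wrap // !potential_mk //.
split; [apply: (@potential_le _ _ _ _ _ _ (j + 1)%ring)
       |apply: (@potential_le _ _ _ _ _ _ j)] => i; rewrite /lamp_weight addrK.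
  case: (eqVneq i j) => //.
  case: (eqVneq i (j + 1)%ring) => [_|_]; first by lia.
  case: (i == (j - 1)%ring); case: (i == (j + 1 + 1)%ring); lia.
case: (eqVneq i j) => [->|_].
  rewrite ![j == _]eq_sym.
  have /eqP/negbTE -> := @succ_neq n j; have /eqP/negbTE -> := @succ2_neq n j; lia.
case: (i == (j + 1)%ring) => //.
case: (i == (j - 1)%ring); case: (i == (j + 1 + 1)%ring); lia.
Qed.

Lemma potential_near n r s0 k (c d : surface n r) :
  near k c d -> potential s0 c <= potential s0 d + k.
Proof.
elim: k d => [|k IH] d; first by rewrite /near inE => /eqP ->; rewrite addn0.
case/nearS => [/IH|[e /IH ce /(potential_adj s0)[ed _]]]; lia.
Qed.

(** * Separated points and scaling limits *)

(** The shift by one and the three spare lamps keep the coding lamps away from lamps 0 and -1, so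
    that each has full weight [r.+1] as seen from height 0 of strip 0. *)
Definition lamp_of m (w : {ffun 'I_m -> bool}) : 'I_(expn 2 m).+3 := inord (enum_rank w).+1.

(** The [a]-th coordinate function on the cube, extended by [false] to the spare lamps. *)
Definition codeword m (a : 'I_m) : {ffun 'I_(expn 2 m).+3 -> bool} :=
  [ffun l => [exists w : {ffun 'I_m -> bool}, (l == lamp_of w) && w a]].

Definition code_cell m r (a : 'I_m) : surface (expn 2 m) r := mk r (codeword a) 0%ring 0 0.

Lemma enum_rank_lt m (w : {ffun 'I_m -> bool}) : enum_rank w < expn 2 m.
Proof.
by apply: leq_trans (ltn_ord (enum_rank w)) _; rewrite card_ffun card_bool card_ord.
Qed.

Lemma lamp_ofE m (w : {ffun 'I_m -> bool}) : lamp_of w = (enum_rank w).+1 :> nat.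
Proof.
have h := enum_rank_lt w.
by rewrite /lamp_of inordK //; lia.
Qed.

Lemma lamp_of_inj m : injective (@lamp_of m).
Proof.
move=> w w' /(congr1 (@nat_of_ord _)); rewrite !lamp_ofE => -[/val_inj].
exact: enum_rank_inj.
Qed.

Lemma codeword_lamp m (a : 'I_m) w : codeword a (lamp_of w) = w a.
Proof.
rewrite ffunE; apply/existsP/idP => [[w' /andP[/eqP /lamp_of_inj ->]]|wa] //.
by exists w; rewrite eqxx.
Qed.

(** Flipping coordinate [a] exchanges the points of agreement and of disagreement. *)
Lemma card_disagree m (a b : 'I_m) : a != b ->
  2 * #|[set w : {ffun 'I_m -> bool} | w a != w b]| = expn 2 m.
Proof.
move=> ab.
pose swap (w : {ffun 'I_m -> bool}) : {ffun 'I_m -> bool} := [ffun i => w i (+) (i == a)].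
have swapK : involutive swap by move=> w; apply/ffunP => i; rewrite !ffunE addbK.
set A := [set w | _].
have -> : expn 2 m = #|{ffun 'I_m -> bool}| by rewrite card_ffun card_bool card_ord.
rewrite -(cardsC A) mul2n -addnn; congr addn.
rewrite -(card_imset _ (inv_inj swapK)); apply: eq_card => w.
apply/imsetP/idP => [[w' w'A ->]|wA].
  move: w'A; rewrite !inE !ffunE eqxx eq_sym [b == a]eq_sym (negbTE ab).
  by case: (w' a); case: (w' b).
exists (swap w); last by rewrite swapK.
by move: wA; rewrite !inE !ffunE eqxx [b == a]eq_sym (negbTE ab); case: (w a); case: (w b).
Qed.

Lemma potential_code m r (a b : 'I_m) :
  #|[set w : {ffun 'I_m -> bool} | w a != w b]| * r.+1 <= potential (codeword b) (code_cell r a).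
Proof.
rewrite /code_cell potential_mk //.
set D := [set w | _].
rewrite -sum_nat_const.
have -> : \sum_(w in D) r.+1 = \sum_(l in [set lamp_of w | w in D]) r.+1.
  by rewrite big_imset //= => w w' _ _; exact: lamp_of_inj.
rewrite [X in X <= _]big_mkcond /=; apply: leq_sum => l _.
case: ifP => // /imsetP [w]; rewrite inE => wD ->.
rewrite !codeword_lamp wD mul1n /lamp_weight.
have wE := lamp_ofE w.
have h := enum_rank_lt w.
case: eqP => [e|_]; first by move: wE; rewrite e.
(* Lamp 1 has weight [r.+1 - 0]; lamp -1 has number [2 ^ m + 2], beyond all coding lamps. *)
case: ifP => _ //; case: eqP => // e; exfalso; move: wE; rewrite e.
have one : 1 %% (expn 2 m).+3 = 1 by [].
rewrite sub0r /= one modn_small; last by lia.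
by rewrite subn1 /= => -[e1]; move: h; rewrite -e1 ltnNge leqnSn.
Qed.

Lemma potential_self m r (a : 'I_m) : potential (codeword a) (code_cell r a) = 0.
Proof. by rewrite /code_cell potential_mk // big1 // => i _; rewrite eqxx. Qed.

Lemma gdist_code m r (a b : 'I_m) : a != b ->
  expn 2 m * r.+1 <= 2 * gdist (code_cell r a) (code_cell r b).
Proof.
move=> ab; have cG := surface_connected (expn 2 m) r.
have far := potential_near (codeword b) (near_gdist (code_cell r a) (code_cell r b) cG).
have := potential_code r a b; move: far (card_disagree ab); rewrite potential_self.
by move: (expn 2 m) #|_| (potential _ _) (gdist _ _) => e c p d; nia.
Qed.

Lemma gdist_le_gdiam (G : FinGraph) (x y : G) : gdist x y <= gdiam G.
Proof. exact: (@leq_bigmax _ (fun p : G * G => gdist p.1 p.2) (x, y)). Qed.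

Lemma card_surface n r : #|surface n r| = expn 2 n.+3 * n.+3 * (r.+1 * r.+1).
Proof. by rewrite /= !card_prod card_ffun card_bool !card_ord. Qed.

Lemma gdiam_surface_ge m r : 1 < m -> r < gdiam (surface (expn 2 m) r).
Proof.
move=> m1.
pose a : 'I_m := Ordinal (ltnW m1); pose b : 'I_m := Ordinal m1.
have ab : a != b by [].
have := gdist_code r ab; have := gdist_le_gdiam (code_cell r a) (code_cell r b).
have : expn 2 2 <= expn 2 m by rewrite leq_exp2l.
by move: (gdist _ _) (gdiam _) => d D; nia.
Qed.

(** The distance is at least [2 ^ m * r.+1 / 2], and the diameter is at most
    [8 * (2 ^ m + 3) * r.+1], hence at most [16 * 2 ^ m * r.+1] because [2 ^ m >= 4]. *)
Lemma scaled_dist_code m r (a b : 'I_m) : 1 < m -> a != b ->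
  (/ 32 <= scaled_dist (code_cell r a) (code_cell r b))%R.
Proof.
move=> m1 ab; rewrite /scaled_dist.
have D0 := gdiam_surface_ge r m1.
have : gdiam (surface (expn 2 m) r) <= 32 * gdist (code_cell r a) (code_cell r b).
  have := gdist_code r ab; have := gdiam_surface_le (expn 2 m) r.
  have : expn 2 2 <= expn 2 m by rewrite leq_exp2l.
  by move: (gdist _ _) (gdiam _) => d D; nia.
move: (gdist _ _) D0; set D := gdiam _; move: D => D d D0 Dd.
have D0R : (0 < INR D)%R by apply: lt_0_INR; lia.
have /le_INR := elimT leP Dd; rewrite mult_INR => DdR.
apply: (Rmult_le_reg_r (INR D)) => //.
have -> : (INR d / INR D * INR D = INR d)%R by field; lra.
by move: DdR; rewrite /= ; lra.
Qed.

(** * Finite nets and Gromov-Hausdorff approximation *)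

Lemma In_tnth (T : Type) (c : T) (s : seq T) :
  List.In c s -> exists i, tnth (in_tuple s) i = c.
Proof.
elim: s => [|d s IH] //= [->|/IH [i ic]]; first by exists ord0.
by exists (lift ord0 i); move: ic; rewrite !(tnth_nth c).
Qed.

Lemma compact_totally_bounded (M : MetricSpace) (e : R) : mcompact M -> (0 < e)%R ->
  exists (k : nat) (net : 'I_k -> M), forall x, exists i, (mdist (net i) x < e)%R.
Proof.
move=> /(_ M (fun c x => (mdist c x < e)%R)) H e0.
have [s sP] : exists s : list M, forall x, exists i, List.In i s /\ (mdist i x < e)%R.
  apply: H => [c x cx|x]; last first.
    by exists x; rewrite (proj2 (mdist_eq0 x x)).
  exists (e - mdist c x)%R; split; first by lra.
  by move=> y xy; have := mdist_tri c x y; lra.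
exists (size s), (tnth (in_tuple s)) => x.
have [c [cs cx]] := sP x; have [i ic] := In_tnth cs.
by exists i; rewrite ic.
Qed.

(** In the common space each point is within [2 * e] of a net point, and two points sharing one
    would be closer than [4 * e]; so the assignment is injective. *)
Lemma separated_points_le (X : Type) (dX : X -> X -> R) (M : MetricSpace) (e : R)
    (m k : nat) (p : 'I_m -> X) (net : 'I_k -> M) :
  GH_lt dX (@mdist M) e -> (forall x, exists i, (mdist (net i) x < e)%R) ->
  (forall a b, a != b -> (4 * e <= dX (p a) (p b))%R) -> m <= k.
Proof.
move=> [Z [f [g [fX [gM [r [re [fg _]]]]]]]] netP sep.
have /fin_all_exists [h hP] : forall a : 'I_m, exists i : 'I_k,
    (mdist (f (p a)) (g (net i)) < 2 * e)%R.
  move=> a; have [y ay] := fg (p a); have [i iy] := netP y; exists i.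
  have := mdist_tri (f (p a)) (g y) (g (net i)).
  by rewrite gM (mdist_sym y); lra.
suff /leq_card : injective h by rewrite !card_ord.
move=> a b hab; apply/eqP; apply/negPn/negP => /sep; rewrite -fX.
have := hP b; have := hP a; rewrite hab => ha hb.
have := mdist_tri (f (p a)) (g (net (h b))) (f (p b)).
by rewrite (mdist_sym (g _)); lra.
Qed.

Lemma surface_roughly_transitive : exists C K : R, (1 <= C)%R /\ (0 <= K)%R /\
  forall n r, roughly_transitive (surface n r) C K.
Proof.
have [A baseP] := moves_from_base.
(* The constant for going from [x] to the base cell and on to [y]; the successor makes it
   positive. *)
pose B := ((A * A + 3 * A) * A + (A * A + 3 * A) + A).+1.
exists (INR B), (INR (2 * B)); split; last split.
- by rewrite -[1%R]/(INR 1); apply: le_INR; rewrite /B; lia.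
- exact: pos_INR.
move=> n r x y.
have := moves_trans (moves_sym (baseP n r x)) (baseP n r y).
move/(moves_mono (leqnSn _)) => [f [g [fg fxy]]].
by exists f; split=> //; apply: coarse_equiv_quasi_iso fg; first exact: surface_connected.
Qed.

Theorem theorem5 (u : nat -> R)
  (u_pos : forall n, (0 < u n)%R)
  (u_growth : forall A : R, exists N : nat, forall n : nat,
      (N <= n)%N -> (A < u n / (INR n ^ 2))%R) :
  exists C K : R, (1 <= C)%R /\ (0 <= K)%R /\
  exists X : nat -> FinGraph,
    (forall n, gconnected (X n) /\ roughly_transitive (X n) C K) /\
    (exists N : nat, forall n : nat, (N <= n)%N ->
        (INR #|X n| <= u (gdiam (X n)))%R) /\
    ~ (exists phi : nat -> nat,
         (forall m n : nat, (m < n)%N -> (phi m < phi n)%N) /\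
         exists M : CompactMetricSpace,
           has_scaling_limit (fun n => X (phi n)) M).
Proof.
have [C [K [C1 [K0 CK]]]] := surface_roughly_transitive.
exists C, K; split=> //; split=> //.
(* With [2 ^ (n + 2) + 3] lamps fixed, the side is chosen so large that [u(D) / D ^ 2] exceeds the
   number of squares for all [D >= side n]. *)
have [side sideP] := functional_choice _
  (fun n => u_growth (INR (expn 2 (expn 2 n.+2).+3 * (expn 2 n.+2).+3))).
exists (fun n => surface (expn 2 n.+2) (side n)); split; [|split].
- by move=> n; split; [exact: surface_connected|exact: CK].
- exists 0 => n _; rewrite card_surface mult_INR.
  (* The diameter exceeds the side, so the growth bound applies to it and each square has at most
     [D ^ 2] cells. *)
  have D0 : side n < gdiam (surface (expn 2 n.+2) (side n)) by exact: gdiam_surface_ge.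
  have := sideP n _ (ltnW D0).
  move: (INR (expn 2 _ * _)) (pos_INR (expn 2 (expn 2 n.+2).+3 * (expn 2 n.+2).+3)) => A A0.
  move: (gdiam _) D0 => D D0 AD.
  have D0R : (0 < INR D)%R by apply: lt_0_INR; lia.
  have lt_uD : (A * INR D ^ 2 < u D)%R.
    apply: (Rmult_lt_reg_r (/ INR D ^ 2)); first by apply: Rinv_0_lt_compat; apply: pow_lt.
    rewrite Rmult_assoc Rinv_r; last by apply: pow_nonzero; lra.
    by rewrite Rmult_1_r.
  apply: Rle_trans (Rlt_le _ _ lt_uD); apply: Rmult_le_compat_l => //.
  by rewrite -pow_INR; apply: le_INR; rewrite /= ; nia.
case=> phi [phi_mono [M limM]].
have phi_ge n : n <= phi n.
  by elim: n => // n IH; apply: leq_ltn_trans IH (phi_mono _ _ (ltnSn n)).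
(* A quarter of the separation [1 / 32] of the code cells. *)
have e0 : (0 < / 128)%R by lra.
have [k [net netP]] := compact_totally_bounded (@cms_compact M) e0.
have [N limN] := limM _ e0.
(* At this index there are at least [k + 2] separated code cells, too many for a net of [k]
   points. *)
have n_le := phi_ge (maxn N k).
have := separated_points_le (p := @code_cell (phi (maxn N k)).+2 (side (phi (maxn N k))))
  (limN (maxn N k) (leq_maxl N k)) netP.
suff sep : forall a b : 'I_(phi (maxn N k)).+2, a != b -> (4 * / 128 <=
    scaled_dist (code_cell (side (phi (maxn N k))) a) (code_cell (side (phi (maxn N k))) b))%R.
  by move=> /(_ sep); lia.
move=> a b ab; have := scaled_dist_code (side (phi (maxn N k))) (isT : 1 < (phi (maxn N k)).+2) ab.
lra.
Qed.
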